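(* If $\tilde A$ has a positive real eigenvalue, then the closed-loop system $\dot x=F(x)$ has unbounded trajectories, i.e. there exists a solution $x:[0,\infty)\to\mathbb{R}^n$ of $\dot x=F(x)$ with $\sup_{t\ge0}\|x(t)\|=\infty$.
   Context: Data: $A\in\mathbb{R}^{n\times n}$, $B\in\mathbb{R}^{n\times m}$ with $(A,B)$ stabilizable; $c\in\mathbb{R}^n$, $d\in\mathbb{R}$ with $d>0$; $h(x)=c^\top x+d$. The integer $r\ge 1$ is the relative degree of $h$ for $\dot x=Ax+Bu$: $c^\top A^iB=0$ for $0\le i\le r-2$ and $c^\top A^{r-1}B\neq 0$. $\alpha_1,\dots,\alpha_r>0$ are constants and $\alpha=\prod_{i=1}^r\alpha_i$. $G\in\mathbb{R}^{m\times m}$ is symmetric positive definite. $K\in\mathbb{R}^{m\times n}$ is a nominal gain such that $A_0:=A-BK$ is Hurwitz (all eigenvalues have negative real part). Notation: $\phi(s)=\prod_{j=1}^{r}(s+\alpha_j)$; $\theta=c^\top A^{r-1}B\,G^{-1}B^\top(A^\top)^{r-1}c>0$; $v_1=-\frac{1}{\theta}B\,G^{-1}B^\top(A^\top)^{r-1}c$; $v_2^\top=c^\top(\phi(A)-A^{r-1}BK)$; $\tilde A=A_0+v_1v_2^\top$; $\tilde b=\alpha d\,v_1$; $\eta(x)=v_2^\top x+\alpha d$. Closed-loop system: $\dot x=F(x)$ with $F(x)=A_0x$ if $\eta(x)\ge 0$ and $F(x)=\tilde A x+\tilde b$ if $\eta(x)<0$. It arises from $\dot x=Ax+Bu^*(x)$,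 where $u^*(x)$ is the safety filter, i.e. the minimizer of $\frac12 (u+Kx)^\top G(u+Kx)$ over $u\in\mathbb{R}^m$ subject to $c^\top\phi(A)x+c^\top A^{r-1}Bu+\alpha d\ge 0$. *)

(* Defs.v *)
From mathcomp Require Import all_boot all_order all_algebra.
From mathcomp Require Import complex.
From mathcomp Require Import all_classical all_reals all_analysis.

Set Implicit Arguments.
Unset Strict Implicit.
Unset Printing Implicit Defensive.

Import Order.TTheory GRing.Theory Num.Theory.
Import numFieldNormedType.Exports.

Local Open Scope classical_set_scope.
Local Open Scope ring_scope.

(* All eigenvalues are taken in R[i], so a real matrix is first mapped there.
   [eigenvalue] refers to row eigenvectors; for square matrices the
   eigenvalues are the same as for column eigenvectors. *)
Definition hurwitz (R : realType) (n : nat) (M : 'M[R]_n) : Prop :=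
  forall z : R[i], eigenvalue (map_mx (real_complex R) M) z -> complex.Re z < 0.

Definition stabilizable (R : realType) (n m : nat)
    (A : 'M[R]_n) (B : 'M[R]_(n, m)) : Prop :=
  exists L : 'M[R]_(m, n), hurwitz (A - B *m L).

Definition sym_posdef (R : realType) (m : nat) (G : 'M[R]_m) : Prop :=
  G^T = G /\ forall w : 'cV[R]_m, w != 0 -> 0 < (w^T *m G *m w) 0 0.

(* [r] is the relative degree of the output c^T x + d for x' = A x + B u.
   The condition i < r.-1 encodes 0 <= i <= r - 2, which is void when r = 1. *)
Definition relative_degree (R : realType) (n m : nat) (A : 'M[R]_n.+1)
    (B : 'M[R]_(n.+1, m)) (c : 'cV[R]_n.+1) (r : nat) : Prop :=
  [/\ (0 < r)%N,
      forall i : nat, (i < r.-1)%N -> c^T *m A ^+ i *m B = 0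
    & c^T *m A ^+ r.-1 *m B <> 0].

Definition phi (R : realType) (r : nat) (alpha : 'I_r -> R) : {poly R} :=
  \prod_(j < r) ('X + (alpha j)%:P).

Definition theta (R : realType) (n m : nat) (A : 'M[R]_n.+1)
    (B : 'M[R]_(n.+1, m)) (c : 'cV[R]_n.+1) (G : 'M[R]_m) (r : nat) : R :=
  (c^T *m A ^+ r.-1 *m B *m invmx G *m B^T *m A^T ^+ r.-1 *m c) 0 0.

Definition v1 (R : realType) (n m : nat) (A : 'M[R]_n.+1)
    (B : 'M[R]_(n.+1, m)) (c : 'cV[R]_n.+1) (G : 'M[R]_m) (r : nat) :
    'cV[R]_n.+1 :=
  - (theta A B c G r)^-1 *: (B *m invmx G *m B^T *m A^T ^+ r.-1 *m c).

(* This is the row vector v_2^T. *)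
Definition v2T (R : realType) (n m : nat) (A : 'M[R]_n.+1)
    (B : 'M[R]_(n.+1, m)) (c : 'cV[R]_n.+1) (K : 'M[R]_(m, n.+1))
    (r : nat) (alpha : 'I_r -> R) : 'rV[R]_n.+1 :=
  c^T *m (horner_mx A (phi alpha) - A ^+ r.-1 *m B *m K).

Definition Atilde (R : realType) (n m : nat) (A : 'M[R]_n.+1)
    (B : 'M[R]_(n.+1, m)) (c : 'cV[R]_n.+1) (G : 'M[R]_m)
    (K : 'M[R]_(m, n.+1)) (r : nat) (alpha : 'I_r -> R) : 'M[R]_n.+1 :=
  A - B *m K + v1 A B c G r *m v2T A B c K alpha.

Definition btilde (R : realType) (n m : nat) (A : 'M[R]_n.+1)
    (B : 'M[R]_(n.+1, m)) (c : 'cV[R]_n.+1) (d : R) (G : 'M[R]_m)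
    (r : nat) (alpha : 'I_r -> R) : 'cV[R]_n.+1 :=
  ((\prod_(j < r) alpha j) * d) *: v1 A B c G r.

Definition eta (R : realType) (n m : nat) (A : 'M[R]_n.+1)
    (B : 'M[R]_(n.+1, m)) (c : 'cV[R]_n.+1) (d : R) (K : 'M[R]_(m, n.+1))
    (r : nat) (alpha : 'I_r -> R) (x : 'cV[R]_n.+1) : R :=
  (v2T A B c K alpha *m x) 0 0 + (\prod_(j < r) alpha j) * d.

Definition closed_loop (R : realType) (n m : nat) (A : 'M[R]_n.+1)
    (B : 'M[R]_(n.+1, m)) (c : 'cV[R]_n.+1) (d : R) (G : 'M[R]_m)
    (K : 'M[R]_(m, n.+1)) (r : nat) (alpha : 'I_r -> R) (x : 'cV[R]_n.+1) :
    'cV[R]_n.+1 :=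
  if 0 <= eta A B c d K alpha x then (A - B *m K) *m x
  else Atilde A B c G K alpha *m x + btilde A B c d G alpha.

(* [x] solves x' = F x on [0, +oo[: the derivative is two-sided at t > 0 and
   one-sided at 0.  The values of [x] at negative times are irrelevant. *)
Definition solution (R : realType) (n : nat) (F : 'cV[R]_n -> 'cV[R]_n)
    (x : R -> 'cV[R]_n) : Prop :=
  (forall t : R, 0 < t -> is_derive t 1 x (F (x t))) /\
  (h^-1 *: (x h - x 0) @[h --> (0 : R)^'+] --> F (x 0)).

(* The norm is the library's max norm on 'cV[R]_n; in finite dimension all
   norms have the same unbounded trajectories. *)
Definition unbounded_trajectory (R : realType) (n : nat)
    (x : R -> 'cV[R]_n) : Prop :=
  ereal_sup [set (`|x t|)%:E | t in [set t : R | 0 <= t]] = +oo%E.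

(* Main.v *)
Require Import Defs.
From mathcomp Require Import all_boot all_order all_algebra.
From mathcomp Require Import complex.
From mathcomp Require Import all_classical all_reals all_analysis.
From mathcomp Require Import lra.

Set Implicit Arguments.
Unset Strict Implicit.
Unset Printing Implicit Defensive.

Import Order.TTheory GRing.Theory Num.Theory.
Import numFieldNormedType.Exports.
Local Open Scope ring_scope.

(** A trajectory can be written down that stays for ever in the half-space
    eta < 0, where the loop is the affine system x' = M x + b with M = Atilde
    and b = btilde, and that grows along an unstable eigenvector of M.

    Let M w = l w with l > 0.  The eigenvector is seen by the switching
    function: if v_2^T w were 0, then M w = A_0 w and l would be a positive
    eigenvalue of the Hurwitz matrix A_0.  So w can be scaled to v_2^T w = -1.

    The trajectory is x(t) = p(t) + a e^(l t) w, where p is one particular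
    solution of the affine system.  An equilibrium would be the natural p, but
    M may be singular and b need not lie in its range.  There is nevertheless
    always a polynomial p ([affine_poly_solution]): after a translation b is
    annihilated by a power of M ([fitting_shift]), so that the Taylor series of
    the solution is finite.

    Then eta(x(t)) is a polynomial in t minus a e^(l t).  The polynomial is at
    most C e^(l t) ([poly_expR_bound]); with a = C + 1 this gives
    eta(x(t)) <= - e^(l t), which is negative, so that x does solve the closed
    loop, and tends to -oo, so that x is unbounded
    ([unbounded_functional]). *)

(** * Eigenvalues *)

Lemma eigenvalue_unit (F : fieldType) (n : nat) (M : 'M[F]_n) (a : F) :
  eigenvalue M a = (M - a%:M \notin unitmx).
Proof. by rewrite /eigenvalue /eigenspace kermx_eq0 row_free_unit. Qed.

(** Invertibility is stable under transposition; this is what turns the row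
    eigenvectors of [eigenvalue] into column eigenvectors. *)
Lemma eigenvalue_tr (F : fieldType) (n : nat) (M : 'M[F]_n) (a : F) :
  eigenvalue M^T a = eigenvalue M a.
Proof.
by rewrite !eigenvalue_unit -[in RHS]unitmx_tr linearB /= tr_scalar_mx.
Qed.

Lemma eigenvalue_colP (F : fieldType) (n : nat) (M : 'M[F]_n) (a : F) :
  reflect (exists2 w : 'cV[F]_n, M *m w = a *: w & w != 0) (eigenvalue M a).
Proof.
rewrite -eigenvalue_tr; apply: (iffP eigenvalueP) => -[v vM v0]; exists v^T.
- by rewrite -[M]trmxK -trmx_mul vM linearZ.
- by rewrite trmx_eq0.
- by rewrite -trmx_mul vM linearZ.
- by rewrite trmx_eq0.
Qed.

Lemma hurwitz_eigen_lt0 (R : realType) (n : nat) (M : 'M[R]_n) (a : R) :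
  hurwitz M -> eigenvalue M a -> a < 0.
Proof. by move=> hM ha; apply: (hM a%:C%C); rewrite eigenvalue_map. Qed.

(** * Polynomial solutions of affine systems *)

(** The component of b in the range of all powers of M can be absorbed by a
    translation.  The characteristic polynomial is X^k (X g + c) with c <> 0, so
    Cayley-Hamilton gives M^k (M g(M) + c) = 0, and u = c^-1 g(M) b works. *)
Lemma fitting_shift (F : fieldType) (n : nat) (M : 'M[F]_n.+1)
    (b : 'cV[F]_n.+1) :
  exists k (u : 'cV[F]_n.+1), M ^+ k *m (M *m u + b) = 0.
Proof.
have [k [q /implyP q0 charE]] := multiplicity_XsubC (char_poly M) 0.
have {q0} : ~~ root q 0 by apply: q0; rewrite monic_neq0 ?char_poly_monic.
elim/poly_ind: q charE => [|g c _] charE; first by rewrite root0.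
rewrite rootE hornerMXaddC mulr0 add0r => c0.
have := Cayley_Hamilton M; rewrite charE subr0 mulrC [g * _]mulrC.
rewrite rmorphM rmorphXn rmorphD rmorphM /= horner_mx_X horner_mx_C => killed.
exists k, (c^-1 *: (horner_mx M g *m b)).
rewrite -scalemxAr mulmxA -{2}(scalerK c0 b) -scalerDr -(mul_scalar_mx c) -mulmxDl.
by rewrite -scalemxAr mulmxA [X in X *m b]killed mul0mx scaler0.
Qed.

Lemma is_derive_scalel (R : realType) (V : normedModType R) (f : R -> R)
    (t df : R) (v : V) :
  is_derive t 1 f df -> is_derive t 1 (fun s => f s *: v) (df *: v).
Proof.
case=> fd fE.
have h : (h^-1 *: (f (h *: 1 + t) *: v - f t *: v) @[h --> 0^'] --> df *: v)%classic.
  rewrite (_ : (fun _ => _) =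
      (fun h => (h^-1 *: (f (h *: 1 + t) - f t)) *: v)); last first.
    by apply/funext => h; rewrite -scalerBl scalerA.
  by apply: cvgZr_tmp; rewrite -fE; exact: fd.
split; first by apply/cvg_ex; exists (df *: v).
exact: cvg_lim h.
Qed.

(** The recurrence is that of the Taylor coefficients of a solution of
    x' = M x + b.  Started at the u of [fitting_shift], it reads
    a_(j+1) = M^j (M u + b) / (j+1)! and hence reaches 0. *)
Lemma affine_taylor_coefs (R : realType) (n : nat) (M : 'M[R]_n.+1)
    (b : 'cV[R]_n.+1) :
  exists k (a : nat -> 'cV[R]_n.+1), a k.+1 = 0 /\
    forall j, j.+1%:R *: a j.+1 = M *m a j + (j == 0)%:R *: b.
Proof.
have [k [u Mk0]] := fitting_shift M b.
exists k, (fun j => if j is i.+1 then i.+1`!%:R^-1 *: (M ^+ i *m (M *m u + b))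
                    else u).
split=> [|[|j]]; first by rewrite Mk0 scaler0.
  by rewrite factS fact0 muln1 invr1 !scale1r expr0 mul1mx.
rewrite scale0r addr0 -scalemxAr exprS -mulmxE -mulmxA scalerA; congr (_ *: _).
by rewrite factS natrM invfM mulrA divff ?mul1r ?pnatr_eq0.
Qed.

(** Polynomiality is recorded through linear functionals, because the solution is
    only ever observed through v_2^T. *)
Lemma affine_poly_solution (R : realType) (n : nat) (M : 'M[R]_n.+1)
    (b : 'cV[R]_n.+1) :
  exists2 p : R -> 'cV[R]_n.+1,
    forall t : R, is_derive t 1 p (M *m p t + b)
  & forall v : 'rV[R]_n.+1, exists q : {poly R}, forall t,
      (v *m p t) 0 0 = q.[t].
Proof.
have [k [a [ak0 aS]]] := affine_taylor_coefs M b.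
exists (fun t => \sum_(j < k.+1) t ^+ j *: a j) => [t|v].
  have -> : (fun s : R => \sum_(j < k.+1) s ^+ j *: a j) =
            \sum_(j < k.+1) (fun s : R => s ^+ j *: a j).
    by apply/funext => s; rewrite fct_sumE.
  have -> : M *m (\sum_(j < k.+1) t ^+ j *: a j) + b =
            \sum_(j < k.+1) (j%:R * t ^+ j.-1) *: a j.
    (* The term of index k+1, which is 0, is added so that the shift j -> j + 1
       leaves a sum over j < k+1, to be compared termwise by the recurrence. *)
    transitivity (\sum_(j < k.+2) (j%:R * t ^+ j.-1) *: a j); last first.
      by rewrite big_ord_recr /= ak0 scaler0 addr0.
    symmetry; rewrite big_ord_recl mul0r scale0r add0r.
    rewrite (eq_bigr (fun j : 'I_k.+1 =>
        t ^+ j *: (M *m a j) + (t ^+ j * (j == 0%N :> nat)%:R) *: b)); last first.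
      by move=> j _; rewrite lift0 /= mulrC -!scalerA aS scalerDr.
    rewrite big_split /= mulmx_sumr; congr (_ + _).
      by apply: eq_bigr => j _; rewrite -scalemxAr.
    rewrite big_ord_recl big1 /= ?addr0 ?expr0 ?mulr1 ?scale1r // => j _.
    by rewrite mulr0 scale0r.
  apply: is_derive_sum => j; apply: is_derive_scalel.
  have := is_deriveX j (is_derive_id t 1).
  by rewrite exprfctE /= [_ *: 1]mulr1.
exists (\poly_(j < k.+1) (v *m a j) 0 0) => t.
rewrite horner_poly mulmx_sumr summxE; apply: eq_bigr => j _.
by rewrite -scalemxAr mxE mulrC.
Qed.

(** * Exponential growth *)

(** By induction on the polynomial: the extra factor t is at most
    (l/2)^-1 e^(l t / 2), and the other half of the rate is left for the
    induction hypothesis. *)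
Lemma poly_expR_bound (R : realType) (q : {poly R}) (l : R) : 0 < l ->
  exists C : R, forall t : R, 0 <= t -> `|q.[t]| <= C * expR (l * t).
Proof.
elim/poly_ind: q l => [|q c IHq] l l_gt0.
  by exists 0 => t _; rewrite horner0 normr0 mul0r.
have l2_gt0 : 0 < l / 2 by rewrite divr_gt0.
have [C qC] := IHq _ l2_gt0.
exists (C * (l / 2)^-1 + `|c|) => t t_ge0.
rewrite hornerMXaddC (le_trans (ler_normD _ _)) // mulrDl lerD //; last first.
  by rewrite ler_peMr // -expR0 ler_expR mulr_ge0 // ltW.
have -> : expR (l * t) = expR (l / 2 * t) * expR (l / 2 * t).
  by rewrite -expRD -mulrDl -splitr.
rewrite normrM (ger0_norm t_ge0) mulrACA ler_pM ?qC //.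
rewrite ler_pdivlMl // (le_trans _ (expR_ge1Dx _)) //.
by rewrite lerDr.
Qed.

Lemma row_mul_bound (R : realType) (n : nat) (v : 'rV[R]_n) (y : 'cV[R]_n) :
  `|(v *m y) 0 0| <= (\sum_i `|v 0 i|) * `|y|.
Proof.
rewrite mxE (le_trans (ler_norm_sum _ _ _)) // mulr_suml ler_sum // => i _.
rewrite normrM ler_wpM2l // [leRHS]mx_normrE.
exact: (le_bigmax _ (fun ij => `|y ij.1 ij.2|) (i, ord0)).
Qed.

(** A linear functional is bounded, so its blow-up along x forces that of the
    norm. *)
Lemma unbounded_functional (R : realType) (n : nat) (v : 'rV[R]_n)
    (x : R -> 'cV[R]_n) :
  (forall y : R, exists2 t, 0 <= t & y <= `|(v *m x t) 0 0|) ->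
  unbounded_trajectory x.
Proof.
move=> hx; rewrite /unbounded_trajectory.
rewrite (_ : [set _ | _ in _] =
    [set y%:E | y in [set `|x t| | t in [set t | 0 <= t]]])%classic; last first.
  by rewrite image_comp.
apply: hasNub_ereal_sup; last by exists `|x 0|, 0 => //=.
move=> [M hM].
have [t t0] := hx ((\sum_i `|v 0 i|) * M + 1).
rewrite leNgt => /negP; apply.
apply: le_lt_trans (row_mul_bound v (x t)) _.
apply: (@le_lt_trans _ _ ((\sum_i `|v 0 i|) * M)); last by rewrite ltrDl.
rewrite ler_wpM2l //; first by rewrite sumr_ge0.
by apply: hM; exists t.
Qed.

(** * The closed loop *)

(** A two-sided derivative at 0 gives the one-sided limit that a solution needs
    there. *)
Lemma solution_of_derive (R : realType) (n : nat) (F : 'cV[R]_n -> 'cV[R]_n)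
    (x : R -> 'cV[R]_n) :
  (forall t : R, 0 <= t -> is_derive t 1 x (F (x t))) -> solution F x.
Proof.
move=> hx; split=> [t /ltW|]; first exact: hx.
have [xd xE] := hx 0 (lexx 0).
apply: cvg_dnbhs_at_right; rewrite -xE.
rewrite (_ : (fun h => _) = (fun h => h^-1 *: (x (h *: 1 + 0) - x 0))).
  exact: xd.
by apply/funext => h; rewrite addr0 [h *: 1]mulr1.
Qed.

Theorem proposition8 (R : realType) (n m : nat)
    (A : 'M[R]_n.+1) (B : 'M[R]_(n.+1, m))
    (hAB : stabilizable A B)
    (c : 'cV[R]_n.+1) (d : R) (hd : 0 < d)
    (r : nat) (hr : relative_degree A B c r)
    (alpha : 'I_r -> R) (halpha : forall j : 'I_r, 0 < alpha j)
    (G : 'M[R]_m) (hG : sym_posdef G)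
    (K : 'M[R]_(m, n.+1)) (hK : hurwitz (A - B *m K))
    (hpos : exists lambda : R,
      0 < lambda /\ eigenvalue (Atilde A B c G K alpha) lambda) :
  exists x : R -> 'cV[R]_n.+1,
    solution (closed_loop A B c d G K alpha) x /\ unbounded_trajectory x.
Proof.
have [l [l_gt0 /eigenvalue_colP[w0 Mw0 w0_neq0]]] := hpos.
set M := Atilde A B c G K alpha in Mw0 hpos.
set v := v2T A B c K alpha; set b := btilde A B c d G alpha.
(* If v w0 = 0, then w0 is an eigenvector of the Hurwitz matrix A - B K. *)
have vw0 : (v *m w0) 0 0 != 0.
  apply: contraL l_gt0 => /eqP vw0; rewrite -leNgt ltW //.
  apply: (hurwitz_eigen_lt0 hK); apply/eigenvalue_colP; exists w0 => //.
  rewrite -Mw0 /M /Atilde [in RHS]mulmxDl -mulmxA -/v [v *m w0]mx11_scalar vw0.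
  by rewrite raddf0 mulmx0 addr0.
pose w := - ((v *m w0) 0 0)^-1 *: w0.
have Mw : M *m w = l *: w by rewrite -scalemxAr Mw0 !scalerA mulrC.
have vw : (v *m w) 0 0 = -1 by rewrite -scalemxAr mxE mulNr mulVf.
have [p p_sol p_poly] := affine_poly_solution M b.
have [q vp] := p_poly v.
pose D := (\prod_(j < r) alpha j) * d.
have [C qC] := poly_expR_bound (q + D%:P) l_gt0.
pose e t : R := (C + 1) * expR (l * t).
pose x t := p t + e t *: w.
have etaE t : eta A B c d K alpha (x t) = (q + D%:P).[t] - e t.
  rewrite /eta -/v mulmxDr -scalemxAr mxE [X in _ + X + _]mxE vp vw mulrN1.
  by rewrite hornerD hornerC addrAC.
have eta_le (t : R) : 0 <= t -> eta A B c d K alpha (x t) <= - expR (l * t).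
  move=> t0; rewrite etaE /e mulrDl mul1r opprD addrA gerDr subr_le0.
  exact: le_trans (ler_norm _) (qC t t0).
have e_der (t : R) : is_derive t 1 e (l * e t).
  have := is_deriveZ (C + 1)
    (is_derive1_comp (is_derive_expR (l * t)) (is_deriveZ l (is_derive_id t 1))).
  rewrite (_ : _ *: (_ * _) = l * e t) // /e [l *: 1]mulr1 mulrCA.
  by congr (_ * _); rewrite mulrC.
exists x; split.
  apply: solution_of_derive => t t0.
  have /lt_geF eta_lt0 : eta A B c d K alpha (x t) < 0.
    by rewrite (le_lt_trans (eta_le t t0)) // oppr_lt0 expR_gt0.
  rewrite /closed_loop eta_lt0.
  have -> : M *m x t + b = (M *m p t + b) + (l * e t) *: w.
    by rewrite mulmxDr -scalemxAr Mw (scalerA (e t)) mulrC addrAC.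
  exact: is_deriveD (p_sol t) (is_derive_scalel w (e_der t)).
apply: (@unbounded_functional _ _ v) => y.
(* At this t the inequality e^(l t) >= 1 + l t gives
   eta(x(t)) <= - (1 + |y| + |D|), and eta differs from v x by D. *)
pose t := (`|y| + `|D|) / l.
have t0 : 0 <= t by rewrite divr_ge0 ?addr_ge0 // ltW.
exists t => //; have := eta_le t t0.
have := expR_ge1Dx (l * t); rewrite {1}/t mulrCA divff ?gt_eqF // mulr1.
rewrite /eta -/v -/D => ge_exp le_exp.
have Dge := ler_norm (- D); rewrite normrN in Dge.
have vge := ler_norm (- (v *m x t) 0 0); rewrite normrN in vge.
have yge := ler_norm y.
lra.
Qed.
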